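(* Let $A$ be a unital commutative real algebra with $X(A)\neq\emptyset$, let $I$ be the set of all finitely generated unital subalgebras of $A$ ordered by inclusion, and let $\Sigma_I$ be the smallest $\sigma$-algebra on $X(A)$ such that all restriction maps $\pi_S:X(A)\to X(S)$, $S\in I$, are measurable. Then the measurable space $(X(A),\Sigma_I)$ together with the maps $\{\pi_S:S\in I\}$ is the projective limit of the projective system of measurable spaces $\{(X(S),\mathcal{B}_{X(S)}),\pi_{S,T},I\}$. Likewise, the topological space $(X(A),\tau_{X(A)})$ together with the maps $\{\pi_S:S\in I\}$ is the projective limit of the projective system of topological spaces $\{(X(S),\tau_{X(S)}),\pi_{S,T},I\}$. Moreover, $\Sigma_I$ is the smallest $\sigma$-algebra on $X(A)$ making $\hat a:X(A)\to\mathbb{R}$ measurable for all $a\in A$.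
   Context: Subalgebras contain the unit. For a unital commutative real algebra $S$, $X(S)$ denotes the set of all unital $\mathbb{R}$-algebra homomorphisms $\alpha:S\to\mathbb{R}$ (characters), endowed with the weakest topology $\tau_{X(S)}$ such that for every $a\in S$ the function $\hat a=\hat a_S:X(S)\to\mathbb{R}$, $\hat a(\alpha):=\alpha(a)$, is continuous; $\mathcal{B}_{X(S)}$ is the Borel $\sigma$-algebra of $(X(S),\tau_{X(S)})$. For subalgebras $S\subseteq T$ of $A$, $\pi_{S,T}:X(T)\to X(S)$, $\alpha\mapsto\alpha|_S$, is the restriction map, and $\pi_S:=\pi_{S,A}$. Let $(I,\le)$ be a directed partially ordered set. A projective system of measurable spaces $\{(X_i,\Sigma_i),\pi_{i,j},I\}$ consists of measurable spaces $(X_i,\Sigma_i)$ and measurable maps $\pi_{i,j}:X_j\to X_i$ for $i\le j$ with $\pi_{i,j}\circ\pi_{j,k}=\pi_{i,k}$ for $i\le j\le k$ and $\pi_{i,i}=\mathrm{id}$. A projective limit of it is a measurable space $(X_I,\Sigma_I)$ with maps $\pi_i:X_I\to X_i$ such that $\pi_{i,j}\circ\pi_j=\pi_i$ for all $i\le j$, $\Sigma_I$ is the smallest $\sigma$-algebra for which all $\pi_i$ are measurable, and the following universal property holds: for any measurable space $(Y,\Sigma_Y)$ and measurable maps $f_i:Y\to X_i$ $(i\in I)$ with $f_i=\pi_{i,j}\circ f_j$ for all $i\le j$, there is a unique measurable map $f:Y\to X_I$ with $\pi_i\circ f=f_i$ for all $i\in I$. Projective systems and projective limits of topological spaces are defined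 analogously, replacing $\sigma$-algebras by topologies and measurability by continuity. *)

(* Defs.v *)
From HB Require Import structures.
From mathcomp Require Import all_boot all_order all_algebra.
From mathcomp Require Import all_classical all_reals all_analysis.

Set Implicit Arguments.
Unset Strict Implicit.
Unset Printing Implicit Defensive.

Import Order.TTheory GRing.Theory Num.Theory.
Import numFieldNormedType.Exports.

Local Open Scope classical_set_scope.
Local Open Scope ring_scope.

(* [measurableType] only covers nonempty (pointed) spaces. The universal
   property of a projective limit quantifies over all measurable spaces, so a
   sigma-algebra is given here as a set system satisfying [sigma_algebra setT]. *)

Definition measurable_map (X Y : Type) (SX : set_system X) (SY : set_system Y)
    (f : X -> Y) : Prop :=
  forall B, SY B -> SX (f @^-1` B).

Definition initial_sigma (I X : Type) (Y : I -> Type)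
    (SY : forall i, set_system (Y i)) (f : forall i, X -> Y i) :
    set_system X :=
  <<s \bigcup_i [set f i @^-1` B | B in SY i] >>.

Definition is_smallest_sigma (I X : Type) (Y : I -> Type)
    (SY : forall i, set_system (Y i)) (f : forall i, X -> Y i)
    (SX : set_system X) : Prop :=
  [/\ sigma_algebra setT SX,
      forall i, measurable_map SX (SY i) (f i) &
      forall S : set_system X, sigma_algebra setT S ->
        (forall i, measurable_map S (SY i) (f i)) -> SX `<=` S].

Definition directed_poset (d : Order.disp_t) (I : porderType d) : Prop :=
  inhabited I /\ forall i j : I, exists2 k : I, (i <= k)%O & (j <= k)%O.

Section Projective.
Variables (d : Order.disp_t) (I : porderType d).

Record is_meas_proj_system (X : I -> Type) (SX : forall i, set_system (X i))
    (p : forall i j : I, (i <= j)%O -> X j -> X i) : Prop := {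
  mps_directed : directed_poset I;
  mps_sigma : forall i, sigma_algebra setT (SX i);
  mps_measurable : forall (i j : I) (le_ij : (i <= j)%O),
    measurable_map (SX j) (SX i) (p i j le_ij);
  mps_comp : forall (i j k : I)
    (le_ij : (i <= j)%O) (le_jk : (j <= k)%O) (le_ik : (i <= k)%O),
    p i j le_ij \o p j k le_jk = p i k le_ik;
  mps_id : forall (i : I) (le_ii : (i <= i)%O), p i i le_ii = id
}.

Record is_meas_proj_limit (X : I -> Type) (SX : forall i, set_system (X i))
    (p : forall i j : I, (i <= j)%O -> X j -> X i)
    (L : Type) (SL : set_system L) (q : forall i, L -> X i) : Prop := {
  mpl_compat : forall (i j : I) (le_ij : (i <= j)%O), p i j le_ij \o q j = q i;
  mpl_smallest : is_smallest_sigma SX q SL;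
  mpl_universal : forall (Y : Type) (SY : set_system Y)
    (f : forall i, Y -> X i),
    sigma_algebra setT SY ->
    (forall i, measurable_map SY (SX i) (f i)) ->
    (forall (i j : I) (le_ij : (i <= j)%O), f i = p i j le_ij \o f j) ->
    exists! g : Y -> L, measurable_map SY SL g /\ forall i, q i \o g = f i
}.

Record is_top_proj_system (X : I -> topologicalType)
    (p : forall i j : I, (i <= j)%O -> X j -> X i) : Prop := {
  tps_directed : directed_poset I;
  tps_continuous : forall (i j : I) (le_ij : (i <= j)%O),
    continuous (p i j le_ij);
  tps_comp : forall (i j k : I)
    (le_ij : (i <= j)%O) (le_jk : (j <= k)%O) (le_ik : (i <= k)%O),
    p i j le_ij \o p j k le_jk = p i k le_ik;
  tps_id : forall (i : I) (le_ii : (i <= i)%O), p i i le_ii = id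
}.

Definition is_smallest_topology (X : I -> topologicalType)
    (L : topologicalType) (q : forall i, L -> X i) : Prop :=
  (forall i, continuous (q i)) /\
  forall T : Topological L,
    (forall i, continuous (q i : Topological.Pack T -> X i)) ->
    @open L `<=` @open (Topological.Pack T).

Record is_top_proj_limit (X : I -> topologicalType)
    (p : forall i j : I, (i <= j)%O -> X j -> X i)
    (L : topologicalType) (q : forall i, L -> X i) : Prop := {
  tpl_compat : forall (i j : I) (le_ij : (i <= j)%O), p i j le_ij \o q j = q i;
  tpl_smallest : is_smallest_topology q;
  tpl_universal : forall (Y : topologicalType) (f : forall i, Y -> X i),
    (forall i, continuous (f i)) ->
    (forall (i j : I) (le_ij : (i <= j)%O), f i = p i j le_ij \o f j) ->
    exists! g : Y -> L, continuous g /\ forall i, q i \o g = f i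
}.

End Projective.

Section Characters.
Variable R : realType.

(* Unital algebra homomorphisms: [*%R] is the scaling of [R] on itself.
   A [comAlgType] is nonzero; the zero algebra has no character. *)
Definition character (B : comAlgType R) : Type := {lrmorphism B -> R | *%R}.

Definition hat (B : comAlgType R) (a : B) (alpha : character B) : R := alpha a.

HB.instance Definition _ (B : comAlgType R) := gen_eqMixin (character B).
HB.instance Definition _ (B : comAlgType R) := gen_choiceMixin (character B).

(* The supremum over [a] of the topologies induced by [hat a], i.e. the weakest
   topology for which every [hat a] is continuous. *)
HB.instance Definition _ (B : comAlgType R) :=
  Topological.copy (character B)
    (sup_topology (fun a : B => Topological.class (initial_topology (hat a)))).

Definition borel (X : topologicalType) : set_system X := <<s @open X >>.

Definition restr (B C : comAlgType R) (h : {lrmorphism B -> C})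
    (alpha : character C) : character B :=
  alpha \o h.

End Characters.

Section FGSubalgebras.
Variables (R : realType) (A : comAlgType R).

Definition finitely_generated (S : {pred A}) : Prop :=
  exists2 s : seq A, {subset s <= S} &
    forall T : {pred A}, subalg_closed T -> {subset s <= T} -> {subset S <= T}.

Record fgsubalg : Type := FGSubalg {
  fgs_pred :> {pred A};
  fgs_closed : subalg_closed fgs_pred;
  fgs_fingen : finitely_generated fgs_pred
}.

HB.instance Definition _ (S : fgsubalg) :=
  GRing.isSubalgClosed.Build R A (fgs_pred S)
    (GRing.subalg_closed_semi (fgs_closed S)).

Definition fgs_sort (S : fgsubalg) : Type := {x : A | x \in S}.

HB.instance Definition _ (S : fgsubalg) := SubChoice.on (fgs_sort S).
HB.instance Definition _ (S : fgsubalg) :=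
  [SubChoice_isSubAlgebra of fgs_sort S by <:].
HB.instance Definition _ (S : fgsubalg) :=
  [SubNzRing_isSubComNzRing of fgs_sort S by <:].

HB.instance Definition _ := gen_eqMixin fgsubalg.
HB.instance Definition _ := gen_choiceMixin fgsubalg.

Definition fgs_le (S T : fgsubalg) : bool := `[< {subset S <= T} >].

Lemma fgs_le_refl : reflexive fgs_le.
Proof. by move=> S; apply/asboolP. Qed.

Lemma fgs_le_anti : antisymmetric fgs_le.
Proof.
move=> [S cS fS] [T cT fT] /andP[/asboolP /= ST /asboolP /= TS].
have eST : S = T by apply/funext => x; apply/idP/idP; [exact: ST|exact: TS].
by case: T / eST cT fT {ST TS} => cT fT; congr FGSubalg; exact: Prop_irrelevance.
Qed.

Lemma fgs_le_trans : transitive fgs_le.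
Proof.
move=> T S U /asboolP ST /asboolP TU; apply/asboolP => x Sx.
exact/TU/ST.
Qed.

Fact fgsubalg_display : Order.disp_t. Proof. exact. Qed.

HB.instance Definition _ := Order.Le_isPOrder.Build fgsubalg_display fgsubalg
  fgs_le_refl fgs_le_anti fgs_le_trans.

Lemma fgs_leP (S T : fgsubalg) : (S <= T)%O -> {subset S <= T}.
Proof. by move/asboolP. Qed.

Definition fgs_incl (S T : fgsubalg) (le_ST : (S <= T)%O) (x : fgs_sort S) :
    fgs_sort T :=
  exist _ (val x) (fgs_leP le_ST (valP x)).

Section Inclusion.
Variables (S T : fgsubalg) (le_ST : (S <= T)%O).

Fact fgs_incl_is_zmod_morphism : zmod_morphism (fgs_incl le_ST).
Proof. by move=> x y; apply: val_inj. Qed.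

Fact fgs_incl_is_monoid_morphism : monoid_morphism (fgs_incl le_ST).
Proof. by split=> [|x y]; apply: val_inj. Qed.

Fact fgs_incl_is_scalable : scalable (fgs_incl le_ST).
Proof. by move=> k x; apply: val_inj. Qed.

HB.instance Definition _ := GRing.isZmodMorphism.Build _ _ (fgs_incl le_ST)
  fgs_incl_is_zmod_morphism.
HB.instance Definition _ := GRing.isMonoidMorphism.Build _ _ (fgs_incl le_ST)
  fgs_incl_is_monoid_morphism.
HB.instance Definition _ := GRing.isScalable.Build R _ _ *:%R (fgs_incl le_ST)
  fgs_incl_is_scalable.

End Inclusion.

Definition pi_sub (S T : fgsubalg) (le_ST : (S <= T)%O) :
    character (fgs_sort T) -> character (fgs_sort S) :=
  restr (fgs_incl le_ST).

Definition fgs_val (S : fgsubalg) : fgs_sort S -> A := \val.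

HB.instance Definition _ (S : fgsubalg) := GRing.RMorphism.on (@fgs_val S).
HB.instance Definition _ (S : fgsubalg) := GRing.Linear.on (@fgs_val S).

Definition pi_full (S : fgsubalg) : character A -> character (fgs_sort S) :=
  restr (@fgs_val S).

Definition Sigma_I : set_system (character A) :=
  initial_sigma (fun S : fgsubalg => @borel (character (fgs_sort S))) pi_full.

End FGSubalgebras.

(* Main.v *)
Require Import Defs.
From HB Require Import structures.
From mathcomp Require Import all_boot all_order all_algebra.
From mathcomp Require Import all_classical all_reals all_analysis.

Set Implicit Arguments.
Unset Strict Implicit.
Unset Printing Implicit Defensive.

Import Order.TTheory GRing.Theory Num.Theory.
Import numFieldNormedType.Exports.

Local Open Scope classical_set_scope.
Local Open Scope ring_scope.

(** A compatible family of characters on the finitely generated subalgebras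
    glues to a unique character of [A], because any two elements of [A] lie in
    a common finitely generated subalgebra; measurability and continuity of the
    glued map follow since [Sigma_I] and the topology of [X(A)] are initial.
    For the last claim, if [S] is generated by finitely many elements, the
    topology of [X(S)] has a countable base of boxes cut out by rational bounds
    on the generators. Every open set is then a countable union of boxes, so a
    map into [X(S)] is Borel measurable as soon as its composites with the
    functions [hat b] are. *)

(** * Sigma-algebras: generators, countable unions, initial structures *)

Lemma measurable_map_sigma (X Y : Type) (SX : set_system X) (G : set_system Y)
    (f : X -> Y) :
  sigma_algebra setT SX -> measurable_map SX G f ->
  measurable_map SX <<s G >> f.
Proof.
move=> [S0 SC SU] fG.
suff : <<s G >> `<=` [set B | SX (f @^-1` B)] by [].
apply: smallest_sub => //; split => [|B /= /SC|B /=].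
- by rewrite /= preimage_set0.
- by rewrite /= !setTD preimage_setC.
- by rewrite preimage_bigcup; exact: SU.
Qed.

Lemma sigma_algebra_bigcup_count (T : Type) (C : countType)
    (S : set_system T) (P : set C) (F : C -> set T) :
  sigma_algebra setT S -> (forall c, S (F c)) -> S (\bigcup_(c in P) F c).
Proof.
move=> [S0 _ SU] SF.
(* Reindexes the union by the naturals; codes that decode to nothing or fall outside [P] contribute
   the empty set. *)
pose G n := if unpickle n is Some c then if `[< P c >] then F c else set0
            else set0.
have -> : \bigcup_(c in P) F c = \bigcup_n G n.
  apply/seteqP; split => [x [c Pc Fx]|x [n _]].
    by exists (pickle c) => //; rewrite /G pickleK asboolT.
  rewrite /G; case: unpickle => // c; case: asboolP => // Pc Fx.
  by exists c.
by apply: SU => n; rewrite /G; case: unpickle => // c; case: asboolP.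
Qed.

Lemma initial_sigma_smallest (I X : Type) (Y : I -> Type)
    (SY : forall i, set_system (Y i)) (f : forall i, X -> Y i) :
  is_smallest_sigma SY f (initial_sigma SY f).
Proof.
split => [|i B SB|S sS fS].
- exact: smallest_sigma_algebra.
- by apply: sub_sigma_algebra; exists i => //; exists B.
- by apply: smallest_sub => // _ [i _ [B SB <-]]; exact: fS.
Qed.

(** * The weak topology on a character space *)

Section CharacterTopology.
Variables (R : realType) (B : comAlgType R).

Lemma character_ext (u v : character B) : u =1 v -> u = v.
Proof.
case: u => f [[nf] [mf] [sf]]; case: v => g [[ng] [mg] [sg]] /= /funext efg.
case: g / efg ng mg sg => ng mg sg.
by rewrite (Prop_irrelevance nf ng) (Prop_irrelevance mf mg)
  (Prop_irrelevance sf sg).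
Qed.

(** Convergence in a supremum topology is convergence in each constituent, and the neighbourhoods of
    [alpha] induced by [hat b] contain preimages of open sets of reals. *)
Lemma cvg_character (F : set_system (character B)) (alpha : character B) :
  Filter F -> (forall b, hat b @ F --> hat b alpha) -> F --> alpha.
Proof.
move=> FF cF; apply/cvg_sup => b U [? /= [[W oW <-]]] Wa /filterS; apply.
by apply: (cF b); exact: open_nbhs_nbhs.
Qed.

Lemma hat_continuous (b : B) : continuous (hat b).
Proof.
(* The neighbourhood filter of the supremum topology refines that of the topology induced by [hat b]
   alone. *)
move=> alpha; apply: cvg_trans (@initial_continuous _ _ (hat b) alpha).
apply: cvg_app.
pose Tc a := Topological.class (initial_topology (@hat R B a)).
exact: (proj1 (@cvg_sup _ _ Tc _ _ _) (@cvg_id _ (nbhs alpha)) b).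
Qed.

Lemma continuous_character (Y : topologicalType) (g : Y -> character B) :
  (forall b, continuous (hat b \o g)) -> continuous g.
Proof. by move=> cg y; apply: cvg_character => b; exact: cg. Qed.

(** * A countable base when the algebra is finitely generated *)

Section Boxes.
Variable s : seq B.

(** Lists of an index and two rationals form a countable type, and concatenation of lists is
    intersection of boxes. An index past the end of [s] reads [0], where every character vanishes,
    so such an entry gives all or nothing. *)
Definition rat_box (l : seq (nat * (rat * rat))) : set (character B) :=
  [set alpha | all (fun p => ratr p.2.1 < alpha s`_p.1 < ratr p.2.2) l].

Definition box_filter (alpha : character B) : set_system (character B) :=
  filter_from [set l | rat_box l alpha] rat_box.

Lemma box_filter_filter alpha : Filter (box_filter alpha).
Proof.
apply: filter_from_filter => [|l m bl bm]; first by exists [::].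
by exists (l ++ m) => [|beta]; rewrite /rat_box /= all_cat;
  [apply/andP|move/andP].
Qed.

Hypothesis s_gen :
  forall T : {pred B}, subalg_closed T -> {subset s <= T} -> forall b, b \in T.

(* The elements b such that [hat b] converges along the box filter form a
   subalgebra. *)
Lemma box_filter_cvg alpha : box_filter alpha --> alpha.
Proof.
have FF := box_filter_filter alpha.
apply: cvg_character => b.
pose T : {pred B} := fun b => `[< hat b @ box_filter alpha --> hat b alpha >].
suff : b \in T by move/asboolP.
apply: s_gen => [|{}b /(nthP 0)[i _ <-]].
  split=> [|k u v /asboolP cu /asboolP cv|u v /asboolP cu /asboolP cv];
      apply/asboolP.
  - rewrite /hat rmorph1; under eq_fun do rewrite rmorph1.
    exact: cvg_cst.
  - rewrite /hat linearP; under eq_fun do rewrite linearP.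
    by apply: cvgD => //; apply: cvgM => //; exact: cvg_cst.
  - rewrite /hat rmorphM; under eq_fun do rewrite rmorphM.
    exact: cvgM.
apply/asboolP/cvgrPdist_lt => e e0.
(* Rational bounds within [e] on either side of [alpha s]_i[make a one-entry box on which]hat s[_i]
   stays [e]-close. *)
have [p pP] : exists p, ratr p \in `]alpha s`_i - e, alpha s`_i[.
  by apply: rat_in_itvoo; rewrite ltrBlDr ltrDl.
have [q qP] : exists q, ratr q \in `]alpha s`_i, alpha s`_i + e[.
  by apply: rat_in_itvoo; rewrite ltrDl.
exists [:: (i, (p, q))]; rewrite /rat_box /=.
  by rewrite (itvP pP) (itvP qP).
move=> beta; rewrite /= andbT => /andP[pb bq].
rewrite ltr_distlC /hat (lt_trans _ pb) ?(itvP pP)//.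
by rewrite (lt_trans bq) ?(itvP qP).
Qed.

(** An open set is a neighbourhood of each of its points, so convergence of the box filter puts a
    box between the point and the set. *)
Lemma open_bigcup_rat_box (U : set (character B)) :
  open U -> U = \bigcup_(l in [set l | rat_box l `<=` U]) rat_box l.
Proof.
move=> oU; apply/seteqP; split => [alpha Ua|alpha [l /= lU la]]; last exact: lU.
have [l la lU] : box_filter alpha U.
  by apply: box_filter_cvg; exact: open_nbhs_nbhs.
by exists l.
Qed.

Lemma measurable_map_borel (X : Type) (SX : set_system X)
    (f : X -> character B) :
  sigma_algebra setT SX ->
  (forall b, measurable_map SX (@measurable _ R) (hat b \o f)) ->
  measurable_map SX (@borel (character B)) f.
Proof.
move=> sSX mf; apply: measurable_map_sigma => // U /open_bigcup_rat_box ->.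
rewrite preimage_bigcup; apply: sigma_algebra_bigcup_count => // l.
have [ST _ _ SI] := (sigma_algebraP (fun X _ => @subsetT _ X)).1 sSX.
(* The empty list is the whole space; each entry intersects with the preimage of an open interval
   under one [hat]. *)
elim: l => [|[i [p q]] l IHl].
  by rewrite (_ : _ @^-1` _ = setT) //; apply/seteqP; split.
rewrite (_ : _ @^-1` _ =
  ((hat s`_i \o f) @^-1` [set` `]ratr p, ratr q[]) `&` f @^-1` rat_box l).
  by apply: SI => //; apply: mf; exact: measurable_itv.
apply/seteqP; split => x; rewrite /rat_box /preimage /hat/= in_itv /=.
  by move/andP.
by move=> h; apply/andP.
Qed.

End Boxes.

Lemma hat_borel_measurable (b : B) :
  measurable_map (@borel (character B)) (@measurable _ R) (hat b).
Proof.
have -> : @measurable _ R = <<s @measurable_realfun.RGenOpens.G R >>.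
  exact: measurable_realfun.RGenOpens.measurableE.
apply: measurable_map_sigma; first exact: smallest_sigma_algebra.
move=> _ [x [y ->]]; apply: sub_sigma_algebra.
by apply: open_comp (@interval_open _ _ _ _ _) => // ? _; exact: hat_continuous.
Qed.

End CharacterTopology.

Lemma measurable_map_comp (X Y Z : Type) (SX : set_system X)
    (SY : set_system Y) (SZ : set_system Z) (f : X -> Y) (g : Y -> Z) :
  measurable_map SX SY f -> measurable_map SY SZ g ->
  measurable_map SX SZ (g \o f).
Proof. by move=> mf mg U /mg/mf. Qed.

Lemma continuous_borel (X Y : topologicalType) (f : X -> Y) :
  continuous f -> measurable_map (@borel X) (@borel Y) f.
Proof.
move=> cf; apply: measurable_map_sigma; first exact: smallest_sigma_algebra.
by move=> U oU; apply: sub_sigma_algebra; apply: open_comp oU => ? _; exact: cf.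
Qed.

Lemma restr_continuous (R : realType) (B C : comAlgType R)
  (h : {lrmorphism B -> C}) : continuous (restr h).
Proof. by apply: continuous_character => b; exact: hat_continuous. Qed.

(** * Finitely generated subalgebras and their directedness *)

Section FGSubalgebraTheory.
Variables (R : realType) (A : comAlgType R).

(** Taken as the intersection of all subalgebras containing [s], which makes minimality
    immediate. *)
Definition span_pred (s : seq A) : {pred A} :=
  fun x => `[< forall T : {pred A}, subalg_closed T -> {subset s <= T} ->
               x \in T >].

Lemma span_pred_closed s : subalg_closed (span_pred s).
Proof.
split=> [|k u v /asboolP Tu /asboolP Tv|u v /asboolP Tu /asboolP Tv];
  apply/asboolP => T cT sT; have [T1 TL TM] := cT.
- exact: T1.
- by apply: TL; [exact: Tu|exact: Tv].
- by apply: TM; [exact: Tu|exact: Tv].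
Qed.

Lemma sub_span_pred s : {subset s <= span_pred s}.
Proof. by move=> x sx; apply/asboolP => T _; exact. Qed.

Lemma span_pred_fingen s : finitely_generated (span_pred s).
Proof.
exists s => [|T cT sT x /asboolP]; first exact: sub_span_pred.
exact.
Qed.

Definition fgs_span (s : seq A) : fgsubalg A :=
  FGSubalg (span_pred_closed s) (span_pred_fingen s).

Lemma fgs_span_le s (T : fgsubalg A) : {subset s <= T} -> (fgs_span s <= T)%O.
Proof.
move=> sT; apply/asboolP => x /asboolP; apply => //; exact: fgs_closed.
Qed.

Lemma fgsubalg_directed : directed_poset (fgsubalg A).
Proof.
split=> [|S T]; first exact: (inhabits (fgs_span [::])).
have [s sS genS] := fgs_fingen S; have [t tT genT] := fgs_fingen T.
exists (fgs_span (s ++ t)); apply/asboolP;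
  [apply: genS|apply: genT] => [|x xs||x xs];
  do ?[exact: span_pred_closed|by apply: sub_span_pred; rewrite mem_cat xs ?orbT].
Qed.

(** Moves the generators from [A] into the algebra [fgs_sort S] itself, where the box argument takes
    place. *)
Lemma fgs_sort_gen (S : fgsubalg A) : exists s : seq (fgs_sort S),
  forall T : {pred fgs_sort S}, subalg_closed T -> {subset s <= T} ->
  forall b, b \in T.
Proof.
have [s sS genS] := fgs_fingen S.
exists (pmap insub s) => T [T1 TL TM] sT [x xS].
(* The image of [T] in [A] is a subalgebra containing [s], hence contains all of [S]. *)
pose T' : {pred A} := fun y => `[< exists2 b : fgs_sort S, b \in T & val b = y >].
suff /asboolP[b bT bx] : x \in T'.
  by rewrite (_ : exist _ _ _ = b) //; exact: val_inj.
apply: genS xS => [|y ys].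
  split=> [|k u v /asboolP[a aT <-] /asboolP[b bT <-]
           |u v /asboolP[a aT <-] /asboolP[b bT <-]]; apply/asboolP.
  - by exists 1.
  - by exists (k *: a + b) => //; exact: TL.
  - by exists (a * b) => //; exact: TM.
have yS := sS _ ys.
apply/asboolP; exists (exist _ y yS) => //; apply: sT.
by rewrite mem_pmap_sub.
Qed.

(** * Gluing a compatible family of characters *)

Section Glue.
Variables (f : forall S : fgsubalg A, character (fgs_sort S)).
Hypothesis fP : forall S T (le_ST : (S <= T)%O), f S = pi_sub le_ST (f T).

Lemma in_fgs_span1 a : a \in fgs_span [:: a].
Proof. by apply: sub_span_pred; rewrite mem_head. Qed.

Definition glue_fun (a : A) : R :=
  f (fgs_span [:: a]) (exist _ a (in_fgs_span1 a)).

(** Any [S] containing an element contains the subalgebra it generates, so compatibility makes the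
    glued value independent of the choice of [S]. *)
Lemma glue_funE (S : fgsubalg A) (x : fgs_sort S) : glue_fun (val x) = f S x.
Proof.
have le : (fgs_span [:: val x] <= S)%O.
  by apply: fgs_span_le => y; rewrite inE => /eqP ->; exact: valP.
by rewrite /glue_fun (fP le) /pi_sub /restr /=; congr (f S _); exact: val_inj.
Qed.

Lemma glue_fun2 (a b : A) : exists S : fgsubalg A, exists x y : fgs_sort S,
  a = val x /\ b = val y.
Proof.
have aS : a \in fgs_span [:: a; b] by apply: sub_span_pred; rewrite mem_head.
have bS : b \in fgs_span [:: a; b].
  by apply: sub_span_pred; rewrite !inE eqxx orbT.
by exists (fgs_span [:: a; b]), (exist _ a aS), (exist _ b bS).
Qed.

Fact glue_fun_is_zmod_morphism : zmod_morphism glue_fun.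
Proof.
move=> a b; have [S [x [y [-> ->]]]] := glue_fun2 a b.
by rewrite -rmorphB !glue_funE rmorphB.
Qed.

Fact glue_fun_is_monoid_morphism : monoid_morphism glue_fun.
Proof.
split=> [|a b].
  by have := glue_funE (1 : fgs_sort (fgs_span [::])); rewrite !rmorph1.
have [S [x [y [-> ->]]]] := glue_fun2 a b.
by rewrite -rmorphM !glue_funE rmorphM.
Qed.

Fact glue_fun_is_scalable : scalable_for *%R glue_fun.
Proof.
move=> k a; have [S [x [_ [-> _]]]] := glue_fun2 a a.
by rewrite -linearZ !glue_funE linearZ.
Qed.

HB.instance Definition _ := GRing.isZmodMorphism.Build A R glue_fun
  glue_fun_is_zmod_morphism.
HB.instance Definition _ := GRing.isMonoidMorphism.Build A R glue_fun
  glue_fun_is_monoid_morphism.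
HB.instance Definition _ := GRing.isScalable.Build R A R *%R glue_fun
  glue_fun_is_scalable.

Definition glue : character A := glue_fun.

Lemma pi_full_glue S : pi_full S glue = f S.
Proof. by apply: character_ext => x; exact: glue_funE. Qed.

End Glue.

Lemma pi_full_inj (alpha beta : character A) :
  (forall S, pi_full S alpha = pi_full S beta) -> alpha = beta.
Proof.
move=> h; apply: character_ext => a.
pose a' : fgs_sort (fgs_span [:: a]) := exist _ a (in_fgs_span1 a).
exact: (congr1 (hat a') (h _)).
Qed.

(** The set-level universal property, shared by the measurable and the topological limit. *)
Lemma pi_full_universal (Y : Type)
    (f : forall S : fgsubalg A, Y -> character (fgs_sort S)) :
  (forall S T (le_ST : (S <= T)%O), f S = pi_sub le_ST \o f T) ->
  exists! g : Y -> character A, forall S, @pi_full R A S \o g = f S.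
Proof.
move=> fP.
have fPy y S T (le_ST : (S <= T)%O) : f S y = pi_sub le_ST (f T y).
  by rewrite {1}(fP S T le_ST).
exists (fun y => glue (fPy y)); split=> [S|g gP].
  by apply/funext => y; exact: pi_full_glue.
apply/funext => y; apply: pi_full_inj => S.
by rewrite pi_full_glue -gP.
Qed.

(** Each [hat a] factors through one restriction map, which carries measurability and continuity
    over to it. *)
Lemma hat_pi_full (a : A) :
  hat a = hat (exist _ a (in_fgs_span1 a) : fgs_sort _) \o
          pi_full (fgs_span [:: a]).
Proof. by []. Qed.

End FGSubalgebraTheory.

Theorem theorem2p2 (R : realType) (A : comAlgType R)
    (hA : [set: character A] !=set0) :
  [/\ is_meas_proj_system
        (fun S : fgsubalg A => @borel (character (fgs_sort S))) (@pi_sub R A) /\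
      is_meas_proj_limit
        (fun S : fgsubalg A => @borel (character (fgs_sort S))) (@pi_sub R A)
        (@Sigma_I R A) (@pi_full R A),
      is_top_proj_system
        (X := fun S : fgsubalg A => character (fgs_sort S)) (@pi_sub R A) /\
      is_top_proj_limit
        (X := fun S : fgsubalg A => character (fgs_sort S)) (@pi_sub R A)
        (@pi_full R A) &
      is_smallest_sigma (fun _ : A => @measurable _ R) (@hat R A)
        (@Sigma_I R A)].
Proof.
have pi_comp (S T U : fgsubalg A) (le_ST : (S <= T)%O) (le_TU : (T <= U)%O)
    (le_SU : (S <= U)%O) : pi_sub le_ST \o pi_sub le_TU = pi_sub le_SU.
  apply/funext => alpha; apply: character_ext => x.
  by congr (alpha _); exact: val_inj.
have pi_id (S : fgsubalg A) (le_SS : (S <= S)%O) : pi_sub le_SS = id.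
  apply/funext => alpha; apply: character_ext => x.
  by congr (alpha _); exact: val_inj.
have pi_compat (S T : fgsubalg A) (le_ST : (S <= T)%O) :
    pi_sub le_ST \o @pi_full R A T = @pi_full R A S.
  by apply/funext => alpha; exact: character_ext.
have [sSigma mpi Sigma_min] : is_smallest_sigma
    (fun S : fgsubalg A => @borel (character (fgs_sort S))) (@pi_full R A)
    (@Sigma_I R A) := initial_sigma_smallest _ _.
have cpi (S : fgsubalg A) : continuous (@pi_full R A S).
  exact: restr_continuous.
split.
- split; split=> //.
  + exact: fgsubalg_directed.
  + by move=> S; exact: smallest_sigma_algebra.
  + by move=> S T le_ST; apply: continuous_borel; exact: restr_continuous.
  + move=> Y SY f sSY mf /pi_full_universal[g [gP g_uniq]].
    exists g; split=> [|g' [_ /g_uniq//]]; split=> //.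
    (* It suffices to test the generators of [Sigma_I]; their preimages under [g] are preimages
       under the [f S]. *)
    apply: measurable_map_sigma => // _ [S _ [B mB <-]].
    by rewrite -comp_preimage gP; exact: mf.
- split; split=> //.
  + exact: fgsubalg_directed.
  + by move=> S T le_ST; exact: restr_continuous.
  + split=> // T cT U oU.
    (* Comparing the two topologies amounts to continuity of the identity, which is checked on each
       [hat a]. *)
    pose h : Topological.Pack T -> character A := id.
    suff ch : continuous h by exact: (open_comp (fun x _ => ch x) oU).
    apply: continuous_character => a.
    rewrite hat_pi_full -compA => x; apply: continuous_comp.
      exact: (cT (fgs_span [:: a])).
    exact: hat_continuous.
  + move=> Y f cf /pi_full_universal[g [gP g_uniq]].
    exists g; split=> [|g' [_ /g_uniq//]]; split=> //.
    apply: continuous_character => a; rewrite hat_pi_full -compA gP => y.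
    by apply: continuous_comp; [exact: cf|exact: hat_continuous].
- split=> // [a|S sS mhat].
    rewrite hat_pi_full; apply: measurable_map_comp; first exact: mpi.
    exact: hat_borel_measurable.
  (* Finite generation of [T] enters here: measurability of all [hat b] after restriction to [T]
     gives Borel measurability of the restriction map. *)
  apply: Sigma_min => // T; have [s genT] := fgs_sort_gen T.
  by apply: (measurable_map_borel genT) => // b; exact: mhat (val b).
Qed.
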